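(* The modal logic $\Gamma(\mathbf{LP}_2,2,1)$ has the uniform Lyndon interpolation property.
   Context: Modal formulas use variables, $\bot,\land,\lor,\neg,\to,\Box$. Positive/negative variables: $v^+(p)=\{p\}$, $v^-(p)=\emptyset$, $v^\circ(\bot)=\emptyset$, $\land,\lor,\Box$ preserve polarity, $v^\pm(\neg\varphi)=v^\mp(\varphi)$, $v^+(\varphi\to\psi)=v^-(\varphi)\cup v^+(\psi)$, $v^-(\varphi\to\psi)=v^+(\varphi)\cup v^-(\psi)$. $\Gamma(\mathbf{LP}_2,2,1)$ is the set of modal formulas true at every world of every Kripke model on every finite frame of the following form: $W=\{r\}\cup C^0\cup\dots\cup C^{j}$ ($j\ge 0$) where the $C^k$ are pairwise disjoint two-element sets not containing $r$, and $R$ is reflexive, $rRx$ for all $x$, $xRy$ for all $x,y$ in the same $C^k$, and no other pairs (a root below finitely many two-element final clusters). A logic $L$ has the uniform Lyndon interpolation property iff for every formula $\varphi$ and finite sets $P^+,P^-$ of variables there is $\theta$ with $L\vdash\varphi\to\theta$, $v^\circ(\theta)\subseteq v^\circ(\varphi)\setminus P^\circ$ for $\circ\in\{+,-\}$, and $L\vdash\theta\to\psi$ for every $\psi$ with $L\vdash\varphi\to\psi$ and $v^\circ(\psi)\cap P^\circ=\emptyset$ for $\circ\in\{+,-\}$. *)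

(* Defs.v *)
From mathcomp Require Import all_boot.
From mathcomp Require Import finmap.

Set Implicit Arguments.
Unset Strict Implicit.
Unset Printing Implicit Defensive.

Local Open Scope fset_scope.

Inductive formula : Type :=
| Var of nat
| Bot
| And of formula & formula
| Or of formula & formula
| Neg of formula
| Imp of formula & formula
| Box of formula.

Inductive polarity : Type := Plus | Minus.

Definition flip (s : polarity) : polarity :=
  match s with Plus => Minus | Minus => Plus end.

Fixpoint vars (s : polarity) (phi : formula) : {fset nat} :=
  match phi with
  | Var p => match s with Plus => [fset p] | Minus => fset0 end
  | Bot => fset0
  | And phi1 phi2 | Or phi1 phi2 => vars s phi1 `|` vars s phi2
  | Neg phi1 => vars (flip s) phi1
  | Imp phi1 phi2 => vars (flip s) phi1 `|` vars s phi2
  | Box phi1 => vars s phi1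
  end.

Fixpoint sat (W : finType) (R : rel W) (V : nat -> pred W) (x : W)
    (phi : formula) : bool :=
  match phi with
  | Var p => V p x
  | Bot => false
  | And phi1 phi2 => sat R V x phi1 && sat R V x phi2
  | Or phi1 phi2 => sat R V x phi1 || sat R V x phi2
  | Neg phi1 => ~~ sat R V x phi1
  | Imp phi1 phi2 => sat R V x phi1 ==> sat R V x phi2
  | Box phi1 => [forall y, R x y ==> sat R V y phi1]
  end.

(* A root r below the j + 1 two-element final clusters C 0, ..., C j. *)
Definition LP2_2_1_frame (W : finType) (R : rel W) : Prop :=
  exists (r : W) (j : nat) (C : 'I_j.+1 -> {set W}),
    [/\ forall k, #|C k| = 2 /\ r \notin C k,
        forall k l : 'I_j.+1, k != l -> C k :&: C l = set0,
        forall x, x = r \/ exists k, x \in C k &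
        forall x y, R x y <->
          [\/ x = y, x = r | exists k, x \in C k /\ y \in C k]].

Definition Gamma_LP2_2_1 (phi : formula) : Prop :=
  forall (W : finType) (R : rel W), LP2_2_1_frame R ->
  forall (V : nat -> pred W) (x : W), sat R V x phi.

(* A logic L is given by its set of theorems. *)
Definition ULIP (L : formula -> Prop) : Prop :=
  forall (phi : formula) (P : polarity -> {fset nat}),
  exists theta : formula,
    [/\ L (Imp phi theta),
        forall s, vars s theta `<=` vars s phi `\` P s &
        forall psi : formula, L (Imp phi psi) ->
          (forall s, vars s psi `&` P s = fset0) -> L (Imp theta psi)].

(* Main.v *)
(** Order models by polarity-directed bisimulation: [M <=_Q N] preserves every
formula whose positive and negative variables lie in [Q Plus] and [Q Minus].
Over finite [Q] each [M] has a characteristic formula, true exactly in the [N]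
with [M <=_Q N]; the interpolant is the disjunction of the characteristic
formulas of the finitely many models of [phi] over its own variables, with
[Q s = vars s phi \ P s].  It implies [psi] by amalgamation: if [M <=_Q N], some
frame of the class carries [K] with [M <= K] for the variables of [phi] and
[K <= N] for those of [psi].  The points of [K] are related pairs of points, and
two-element clusters suffice because a relation between two pairs that is total
on both sides contains a perfect matching. *)

From mathcomp Require Import all_boot.
From mathcomp Require Import finmap.
Require Import Defs.

Set Implicit Arguments.
Unset Strict Implicit.
Unset Printing Implicit Defensive.

Local Open Scope fset_scope.

(** * Evaluation in coded models *)

Notation val := {fset nat}.

(* [fsat v w] evaluates at a point of valuation [v] whose final cluster has the
   other point [w]; [rsat u S] evaluates at a root of valuation [u] below the
   final clusters [S]. *)
Fixpoint fsat (v w : val) (phi : formula) : bool :=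
  match phi with
  | Var p => p \in v
  | Bot => false
  | And phi1 phi2 => fsat v w phi1 && fsat v w phi2
  | Or phi1 phi2 => fsat v w phi1 || fsat v w phi2
  | Neg phi1 => ~~ fsat v w phi1
  | Imp phi1 phi2 => fsat v w phi1 ==> fsat v w phi2
  | Box phi1 => fsat v w phi1 && fsat w v phi1
  end.

Fixpoint rsat (u : val) (S : seq (val * val)) (phi : formula) : bool :=
  match phi with
  | Var p => p \in u
  | Bot => false
  | And phi1 phi2 => rsat u S phi1 && rsat u S phi2
  | Or phi1 phi2 => rsat u S phi1 || rsat u S phi2
  | Neg phi1 => ~~ rsat u S phi1
  | Imp phi1 phi2 => rsat u S phi1 ==> rsat u S phi2
  | Box phi1 =>
      rsat u S phi1 && all (fun c => fsat c.1 c.2 (Box phi1)) S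
  end.

(** Testing roots is enough: a final point satisfies the same formulas as a root with its valuation
    below its cluster alone. The sequence is nonempty because frames of the class have at least one
    cluster. *)
Definition valid (phi : formula) : Prop :=
  forall u S, S != [::] -> rsat u S phi.

(* Allows truth in a final cluster to be tested at a root. *)
Lemma rsat_duplicate_root v w phi : rsat v [:: (v, w)] phi = fsat v w phi.
Proof.
elim: phi => //= [f -> g ->|f -> g ->|f ->|f -> g ->|f ->] //.
by rewrite andbT andbA andbb.
Qed.

Lemma fsat_Box_swap v w phi : fsat v w (Box phi) = fsat w v (Box phi).
Proof. by rewrite /= andbC. Qed.

(** * Polarity bounds on the variables of a formula *)

Definition pol_sub (Q : polarity -> val) (phi : formula) : Prop :=
  forall s, vars s phi `<=` Q s.

Lemma flipK : involutive flip.
Proof. by case. Qed.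

Lemma pol_sub_And Q f g : pol_sub Q (And f g) <-> pol_sub Q f /\ pol_sub Q g.
Proof.
split=> [H|[Hf Hg] s] /=; last by rewrite fsubUset Hf Hg.
by split=> s; have := H s; rewrite /= fsubUset => /andP[].
Qed.

Lemma pol_sub_Or Q f g : pol_sub Q (Or f g) <-> pol_sub Q f /\ pol_sub Q g.
Proof. exact: pol_sub_And. Qed.

Lemma pol_sub_Box Q f : pol_sub Q (Box f) <-> pol_sub Q f.
Proof. by []. Qed.

Lemma pol_sub_Neg Q f : pol_sub Q (Neg f) <-> pol_sub (Q \o flip) f.
Proof. by split=> H s; have := H (flip s); rewrite /= flipK. Qed.

Lemma pol_sub_Imp Q f g :
  pol_sub Q (Imp f g) <-> pol_sub (Q \o flip) f /\ pol_sub Q g.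
Proof.
split=> [H|[Hf Hg] s] /=.
  split=> s; last by have := H s; rewrite /= fsubUset => /andP[].
  by have := H (flip s); rewrite /= flipK fsubUset => /andP[].
by rewrite fsubUset Hg andbT; have := Hf (flip s); rewrite /= flipK.
Qed.

Lemma pol_sub_flip_const X f :
  pol_sub ((fun=> X) \o flip) f <-> pol_sub (fun=> X) f.
Proof. by []. Qed.

(** * From Kripke models to codes *)

Section KripkeCodes.

Variables (W : finType) (R : rel W) (V : nat -> pred W).

(** A valuation concerns infinitely many variables and a code only finitely many, so the two are
    compared only on [X], which bounds the formula at hand. *)
Variables (X : val) (e : W -> val).
Hypothesis e_V : forall x p, p \in X -> V p x = (p \in e x).

(** Both points are treated at once, since a box at one of them also inspects the other. *)
Lemma sat_final_cluster x y phi :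
  (forall z, R x z = (z == x) || (z == y)) ->
  (forall z, R y z = (z == x) || (z == y)) ->
  pol_sub (fun=> X) phi ->
  sat R V x phi = fsat (e x) (e y) phi /\
  sat R V y phi = fsat (e y) (e x) phi.
Proof.
move=> Rx Ry.
elim: phi => [p||f IHf g IHg|f IHf g IHg|f IHf|f IHf g IHg|f IH] //=.
- by move=> /(_ Plus); rewrite /= fsub1set => Xp; rewrite !e_V.
- by move=> /pol_sub_And[/IHf[-> ->] /IHg[-> ->]].
- by move=> /pol_sub_And[/IHf[-> ->] /IHg[-> ->]].
- by move=> /pol_sub_Neg/pol_sub_flip_const/IHf[-> ->].
- by move=> /pol_sub_Imp[/pol_sub_flip_const/IHf[-> ->] /IHg[-> ->]].
- move=> /IH[<- <-]; split; apply/forallP/andP => [H|[Hx Hy] z].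
  + split; [have := H x | have := H y]; by rewrite Rx eqxx ?orbT.
  + by rewrite Rx; apply/implyP => /orP[] /eqP->.
  + split; [have := H y | have := H x]; by rewrite Ry eqxx ?orbT.
  + by rewrite Ry; apply/implyP => /orP[] /eqP->.
Qed.

Lemma sat_root r (ps : seq (W * W)) phi :
  (forall z, R r z) ->
  (forall z, z = r \/ exists2 c, c \in ps & z = c.1 \/ z = c.2) ->
  (forall c, c \in ps -> forall z, R c.1 z = (z == c.1) || (z == c.2)) ->
  (forall c, c \in ps -> forall z, R c.2 z = (z == c.1) || (z == c.2)) ->
  pol_sub (fun=> X) phi ->
  sat R V r phi =
  rsat (e r) [seq (e c.1, e c.2) | c <- ps] phi.
Proof.
move=> Rr cover R1 R2.
elim: phi => [p||f IHf g IHg|f IHf g IHg|f IHf|f IHf g IHg|f IH] //=.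
- by move=> /(_ Plus); rewrite /= fsub1set => /e_V.
- by move=> /pol_sub_And[/IHf-> /IHg->].
- by move=> /pol_sub_And[/IHf-> /IHg->].
- by move=> /pol_sub_Neg/pol_sub_flip_const/IHf->.
- by move=> /pol_sub_Imp[/pol_sub_flip_const/IHf-> /IHg->].
- move=> Hf; have {}Hf : pol_sub (fun=> X) f := Hf; rewrite -IH //.
  have cl c : c \in ps -> fsat (e c.1) (e c.2) f && fsat (e c.2) (e c.1) f =
      sat R V c.1 f && sat R V c.2 f.
    by move=> cps; have [-> ->] := sat_final_cluster (R1 c cps) (R2 c cps) Hf.
  apply/forallP/andP => [H|[Hr /allP HS] z].
    split; first by have := H r; rewrite Rr.
    apply/allP => _ /mapP[c cps ->]; rewrite /= cl //.
    by have := H c.1; have := H c.2; rewrite !Rr /= => -> ->.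
  rewrite Rr /=; case: (cover z) => [->//|[c cps zc]].
  have /HS := map_f (fun c => (e c.1, e c.2)) cps.
  by rewrite /= cl // => /andP[]; case: zc => ->.
Qed.

End KripkeCodes.

Lemma pol_sub_allvars phi :
  pol_sub (fun=> vars Plus phi `|` vars Minus phi) phi.
Proof. by case; rewrite ?fsubsetUl ?fsubsetUr. Qed.

Lemma valid_Gamma phi : valid phi -> Gamma_LP2_2_1 phi.
Proof.
move=> Hphi W R [r [j [C [HC disj cover HR]]]] V x.
have [X Xphi] : exists X, pol_sub (fun=> X) phi.
  by exists (vars Plus phi `|` vars Minus phi); apply: pol_sub_allvars.
pose e x := [fset p in X | V p x].
have e_V y p : p \in X -> V p y = (p \in e y) by move=> Xp; rewrite !inE Xp.
have card2 k : exists c : W * W, C k = [set c.1; c.2].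
  by have [/eqP/cards2P[a [b [_ ->]]] _] := HC k; exists (a, b).
have [c Hc] := fin_all_exists card2.
have c1 k : (c k).1 \in C k by rewrite Hc !inE eqxx.
have c2 k : (c k).2 \in C k by rewrite Hc !inE eqxx orbT.
have Rr z : R r z by apply/HR; constructor 2.
have RC k y z : y \in C k -> R y z = (z == (c k).1) || (z == (c k).2).
  move=> yk; apply/idP/orP => [/HR[<-|yr|[l [yl zl]]]|H].
  - by move: yk; rewrite Hc !inE => /orP.
  - by have [_] := HC k; rewrite -yr yk.
  - have [kl|/disj/setP/(_ y)] := eqVneq k l; last by rewrite !inE yk yl.
    by move: zl; rewrite -kl Hc !inE => /orP.
  - by apply/HR; constructor 3; exists k; rewrite yk; case: H => /eqP->.
case: (cover x) => [->|[k xk]].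
  rewrite (@sat_root W R V X e e_V r [seq c k | k <- enum 'I_j.+1]) //.
  - by apply: Hphi; rewrite -size_eq0 2!size_map size_enum_ord.
  - move=> z; case: (cover z) => [->|[k zk]]; [by left|right].
    exists (c k); first by apply/mapP; exists k; rewrite ?mem_enum.
    by move: zk; rewrite Hc !inE => /orP[] /eqP; [left|right].
  - by move=> _ /mapP[k _ ->] z; apply: RC (c1 k).
  - by move=> _ /mapP[k _ ->] z; apply: RC (c2 k).
(* A final point is turned into a root duplicating it below its own cluster, to which validity
   applies. *)
have [s1 s2] := @sat_final_cluster W R V X e e_V _ _ phi
   (fun z => RC k _ z (c1 k)) (fun z => RC k _ z (c2 k)) Xphi.
move: xk; rewrite Hc !inE => /orP[] /eqP->.
  by rewrite s1 -rsat_duplicate_root; apply: Hphi.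
by rewrite s2 -rsat_duplicate_root; apply: Hphi.
Qed.

(** * From codes to Kripke models *)

Section CodeFrame.

Variables (u : val) (S : seq (val * val)).
(** As [S] is nonempty, ['I_n.+1] indexes exactly its entries, and the default value in [cval] is
    never reached. *)
Let n := (size S).-1.
Hypothesis S_neq0 : S != [::].

Definition cW : finType := option ('I_n.+1 * bool).
Definition cR (x y : cW) : bool :=
  match x, y with
  | None, _ => true
  | Some k, Some l => k.1 == l.1
  | Some _, None => false
  end.
Definition cval (x : cW) : val :=
  match x with
  | None => u
  | Some (k, b) => let c := nth (fset0, fset0) S k in if b then c.1 else c.2
  end.
Definition cV (p : nat) (x : cW) : bool := p \in cval x.

Lemma code_frame : LP2_2_1_frame cR.
Proof.
exists None, n, (fun k => [set Some (k, true); Some (k, false)]).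
split=> [k|k l kl|[[k b]|]|x y].
- by rewrite cards2 !inE (inj_eq Some_inj) xpair_eqE andbF.
- apply/setP=> -[[m b]|]; rewrite !inE //=.
  rewrite !(inj_eq Some_inj) !xpair_eqE -!andb_orr.
  by apply/negP => /andP[/andP[/eqP-> _] /andP[/eqP mk _]]; rewrite mk eqxx in kl.
- by right; exists k; rewrite !inE; case: b; rewrite eqxx ?orbT.
- by left.
- split=> [|[->||[k []]]].
  + case: x y => [[k b]|] [[l b']|] //=; try by constructor 2.
    by move/eqP=> <-; constructor 3; exists k; rewrite !inE;
      case: b b' => [] []; rewrite !eqxx ?orbT.
  + by case: y => [[k b]|] /=.
  + by move->.
  + by rewrite !inE => /orP[] /eqP-> /orP[] /eqP-> /=.
Qed.

Lemma sat_code phi : sat cR cV None phi = rsat u S phi.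
Proof.
have sz : size S = n.+1 by rewrite /n prednK // lt0n size_eq0.
have S_enum : S = [seq nth (fset0, fset0) S (nat_of_ord k) | k <- enum 'I_n.+1].
  by rewrite -[LHS](mkseq_nth (fset0, fset0)) sz /mkseq -val_enum_ord -map_comp.
pose ps : seq (cW * cW) :=
  [seq (Some (k, true), Some (k, false)) | k <- enum 'I_n.+1].
rewrite (@sat_root cW cR cV _ cval _ None ps _ _ _ _ _ (@pol_sub_allvars phi)) //.
- congr rsat; rewrite [RHS]S_enum -map_comp; apply: eq_map => k /=.
  by case: nth.
- move=> [[k b]|]; [right|by left].
  exists (Some (k, true), Some (k, false)); first by apply: map_f; rewrite mem_enum.
  by case: b; [left|right].
- move=> _ /mapP[k _ ->] [[l b]|] //=.
  by rewrite !(inj_eq Some_inj) !xpair_eqE -andb_orr eq_sym; case: b; rewrite andbT.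
- move=> _ /mapP[k _ ->] [[l b]|] //=.
  by rewrite !(inj_eq Some_inj) !xpair_eqE -andb_orr eq_sym; case: b; rewrite andbT.
Qed.

End CodeFrame.

Lemma Gamma_valid phi : Gamma_LP2_2_1 phi -> valid phi.
Proof.
by move=> H u S S0; rewrite -sat_code //; apply: H; apply: code_frame.
Qed.

(** * Directed bisimulation and preservation *)

Definition le (Q : polarity -> val) (v w : val) : bool :=
  (v `&` Q Plus `<=` w) && (w `&` Q Minus `<=` v).

(** The bisimulation between two clusters is required to contain a bijection, straight or crossed,
    so that an amalgam of two clusters again has two points. *)
Definition cle Q (c d : val * val) : bool :=
  le Q c.1 d.1 && le Q c.2 d.2 || le Q c.1 d.2 && le Q c.2 d.1.

(** The forth and back clauses match roots with roots and final clusters with final clusters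
    only. *)
Definition mle Q (M N : val * seq (val * val)) : bool :=
  [&& le Q M.1 N.1, all (fun c => has (cle Q c) N.2) M.2
    & all (fun d => has (cle Q ^~ d) M.2) N.2].

(** Exchanging the polarities reverses the order. This is what carries the preservation proofs, by
    induction with [Q] general, through negations and antecedents. *)
Lemma le_flip Q v w : le (Q \o flip) v w = le Q w v.
Proof. by rewrite /le /= andbC. Qed.

Lemma cle_flip Q c d : cle (Q \o flip) c d = cle Q d c.
Proof. by rewrite /cle !le_flip [le Q d.2 c.1 && _]andbC. Qed.

Lemma cle_swap Q c d : cle Q c (d.2, d.1) = cle Q c d.
Proof. by rewrite /cle orbC. Qed.

Lemma mle_flip Q M N : mle (Q \o flip) M N = mle Q N M.
Proof.
rewrite /mle le_flip; congr (_ && _); rewrite andbC; congr (_ && _).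
  by apply: eq_all => d; apply: eq_has => c; apply: cle_flip.
by apply: eq_all => d; apply: eq_has => c; apply: cle_flip.
Qed.

Lemma leP Q v w :
  reflect ((forall p, p \in Q Plus -> p \in v -> p \in w) /\
           (forall p, p \in Q Minus -> p \in w -> p \in v)) (le Q v w).
Proof.
apply: (iffP andP) => [[/fsubsetP H1 /fsubsetP H2]|[H1 H2]].
  by split=> p Qp vp; [apply: H1 | apply: H2]; rewrite inE vp.
by split; apply/fsubsetP => p; rewrite inE => /andP[vp Qp]; [apply: H1 | apply: H2].
Qed.

Lemma fsat_mono Q v w v' w' phi : pol_sub Q phi ->
  le Q v v' -> le Q w w' -> fsat v w phi -> fsat v' w' phi.
Proof.
elim: phi Q v w v' w' =>
  [p||f IHf g IHg|f IHf g IHg|f IHf|f IHf g IHg|f IHf] Q v w v' w' //=.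
- by move=> /(_ Plus); rewrite /= fsub1set => Qp /leP[H _] _; apply: H.
- move=> /pol_sub_And[Qf Qg] lv lw /andP[/(IHf _ _ _ _ _ Qf lv lw)-> ].
  by apply: IHg.
- move=> /pol_sub_And[Qf Qg] lv lw /orP[/(IHf _ _ _ _ _ Qf lv lw)->//|].
  by move/(IHg _ _ _ _ _ Qg lv lw) => ->; rewrite orbT.
- move=> /pol_sub_Neg Qf lv lw; apply: contra.
  by apply: IHf Qf _ _; rewrite le_flip.
- move=> /pol_sub_Imp[Qf Qg] lv lw /implyP H; apply/implyP => Hf.
  apply: (IHg _ _ _ _ _ Qg lv lw); apply: H; move: Hf.
  by apply: IHf Qf _ _; rewrite le_flip.
- move=> Qf lv lw /andP[Hv Hw].
  by rewrite (IHf _ _ _ _ _ Qf lv lw) // (IHf _ _ _ _ _ Qf lw lv).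
Qed.

(** A boxed formula does not distinguish the two points of a cluster, so the crossed matching serves
    as well as the straight one. *)
Lemma fsat_Box_mono Q c d phi : pol_sub Q phi -> cle Q c d ->
  fsat c.1 c.2 (Box phi) -> fsat d.1 d.2 (Box phi).
Proof.
move=> Qf /orP[] /andP[l1 l2]; first exact: (@fsat_mono Q).
by rewrite (fsat_Box_swap d.1); apply: (@fsat_mono Q).
Qed.

Lemma rsat_mono Q M N phi : pol_sub Q phi -> mle Q M N ->
  rsat M.1 M.2 phi -> rsat N.1 N.2 phi.
Proof.
elim: phi Q M N => [p||f IHf g IHg|f IHf g IHg|f IHf|f IHf g IHg|f IHf] Q M N //.
- by move=> /(_ Plus); rewrite /= fsub1set => Qp /and3P[/leP[H _] _ _]; apply: H.
- move=> /pol_sub_And[Qf Qg] MN /andP[/(IHf _ _ _ Qf MN) /= -> ].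
  by apply: IHg.
- move=> /pol_sub_And[Qf Qg] MN /orP[/(IHf _ _ _ Qf MN) /= ->//|].
  by move/(IHg _ _ _ Qg MN) => /= ->; rewrite orbT.
- move=> /pol_sub_Neg Qf MN; apply: contra.
  by apply: IHf Qf _; rewrite mle_flip.
- move=> /pol_sub_Imp[Qf Qg] MN /implyP H; apply/implyP => Hf.
  apply: (IHg _ _ _ Qg MN); apply: H; move: Hf.
  by apply: IHf Qf _; rewrite mle_flip.
- move=> Qf MN /andP[Hr /allP HS]; apply/andP; split; first exact: (IHf _ _ _ Qf MN).
  (* A box needs the back clause; the forth clause plays this part under a negation, where
     [mle_flip] exchanges the two. *)
  have /and3P[_ _ /allP back] := MN.
  by apply/allP => d /back/hasP[c /HS Hc cd]; exact: (@fsat_Box_mono Q c d f).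
Qed.

(** * Characteristic formulas *)

Definition Dia f := Neg (Box (Neg f)).
Definition bigAnd := foldr And (Neg Bot).
Definition bigOr := foldr Or Bot.

(** Falsity of positive variables and truth of negative ones are left unsaid, which keeps the
    formula within the polarities of [Q]. *)
Definition lit (Q : polarity -> val) (v : val) : formula :=
  And (bigAnd [seq Var p | p <- v `&` Q Plus])
      (bigAnd [seq Neg (Var p) | p <- Q Minus `\` v]).

(* [Box Dia] rather than [Dia], so that at a root the formula implies that every
   final cluster satisfies it. *)
Definition cluster_form Q (c : val * val) : formula :=
  And (And (Box (Dia (lit Q c.1))) (Box (Dia (lit Q c.2))))
      (Box (Or (lit Q c.1) (lit Q c.2))).

(** The conjuncts express the root, forth and back clauses of [mle]. The last box also ranges over
    the root, where the disjunction itself may fail; the inner [Dia] allows for this. *)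
Definition char_form Q (M : val * seq (val * val)) : formula :=
  And (lit Q M.1)
      (And (bigAnd [seq Dia (cluster_form Q c) | c <- M.2])
           (Box (Dia (bigOr [seq cluster_form Q c | c <- M.2])))).

Lemma fsat_bigAnd v w s : fsat v w (bigAnd s) = all (fsat v w) s.
Proof. by elim: s => //= f s ->. Qed.

Lemma fsat_bigOr v w s : fsat v w (bigOr s) = has (fsat v w) s.
Proof. by elim: s => //= f s ->. Qed.

Lemma rsat_bigAnd u S s : rsat u S (bigAnd s) = all (rsat u S) s.
Proof. by elim: s => //= f s ->. Qed.

Lemma rsat_bigOr u S s : rsat u S (bigOr s) = has (rsat u S) s.
Proof. by elim: s => //= f s ->. Qed.

Lemma lit_leE Q v w :
  all (fun p => p \in w) (v `&` Q Plus) &&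
  all (fun p => p \notin w) (Q Minus `\` v) = le Q v w.
Proof.
apply/andP/leP => -[].
  move=> /allP H1 /allP H2; split=> p Qp Hp; first by apply: H1; rewrite inE Hp.
  by apply: contraLR Hp => Hp; apply: H2; rewrite inE Hp.
move=> H1 H2; split; apply/allP => p; rewrite inE => /andP[Hp Qp].
  exact: H1.
by apply: contra Hp; apply: H2.
Qed.

Lemma fsat_lit Q v x y : fsat x y (lit Q v) = le Q v x.
Proof. by rewrite /= !fsat_bigAnd !all_map -lit_leE. Qed.

Lemma rsat_lit Q v u S : rsat u S (lit Q v) = le Q v u.
Proof. by rewrite /= !rsat_bigAnd !all_map -lit_leE. Qed.

Lemma fsat_Dia v w f : fsat v w (Dia f) = fsat v w f || fsat w v f.
Proof. by rewrite /= negb_and !negbK. Qed.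

Lemma rsat_Dia u S f :
  rsat u S (Dia f) =
  rsat u S f || has (fun c => fsat c.1 c.2 f || fsat c.2 c.1 f) S.
Proof.
rewrite /= negb_and negbK -has_predC; congr (_ || _).
by apply: eq_has => c /=; rewrite negb_and !negbK.
Qed.

(* The formula says that the relation [le Q] between the clusters is total on
   both sides, [cle] that it contains a perfect matching. *)
Lemma fsat_cluster_form Q c d : fsat d.1 d.2 (cluster_form Q c) = cle Q c d.
Proof.
rewrite /cluster_form /cle.
have E f g : fsat d.1 d.2 (And f g) = fsat d.1 d.2 f && fsat d.1 d.2 g by [].
have B f : fsat d.1 d.2 (Box f) = fsat d.1 d.2 f && fsat d.2 d.1 f by [].
have O v w f g : fsat v w (Or f g) = fsat v w f || fsat v w g by [].
rewrite !E !B !fsat_Dia !O !fsat_lit.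
by do 4!case: (le Q _ _).
Qed.

Lemma rsat_cluster_form u S Q c d : d \in S ->
  rsat u S (cluster_form Q c) -> fsat d.1 d.2 (cluster_form Q c).
Proof.
move=> dS; rewrite /cluster_form.
move=> /andP[/andP[/andP[_ /allP/(_ d dS) H1] /andP[_ /allP/(_ d dS) H2]]].
by move=> /andP[_ /allP/(_ d dS) H3]; apply/andP; split=> //; apply/andP.
Qed.

Lemma rsat_Dia_cluster_form u S Q c : S != [::] ->
  rsat u S (Dia (cluster_form Q c)) = has (cle Q c) S.
Proof.
move=> S0; rewrite rsat_Dia; apply/orP/hasP => [[H|/hasP[d dS H]]|[d dS H]].
(* If the root itself witnesses the diamond, all final clusters satisfy the formula, and the first
   one can be taken. *)
- case: S S0 H => // d S _ H; exists d; first exact: mem_head.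
  by rewrite -fsat_cluster_form; apply: rsat_cluster_form H; apply: mem_head.
- exists d => //; case/orP: H; first by rewrite fsat_cluster_form.
  by rewrite (@fsat_cluster_form Q c (d.2, d.1)) cle_swap.
- by right; apply/hasP; exists d => //; rewrite fsat_cluster_form H.
Qed.

Lemma rsat_char_form Q M N : N.2 != [::] ->
  rsat N.1 N.2 (char_form Q M) = mle Q M N.
Proof.
move=> N0; rewrite /char_form /mle.
have A f g : rsat N.1 N.2 (And f g) = rsat N.1 N.2 f && rsat N.1 N.2 g by [].
rewrite 2!A rsat_lit rsat_bigAnd all_map; congr [&& _, _ & _].
  by apply: eq_all => c; apply: rsat_Dia_cluster_form.
set B := bigOr _.
have HB d : fsat d.1 d.2 B = has (cle Q ^~ d) M.2.
  by rewrite fsat_bigOr has_map; apply: eq_has => c; apply: fsat_cluster_form.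
have HB' d : fsat d.2 d.1 B = has (cle Q ^~ d) M.2.
  by rewrite (HB (d.2, d.1)); apply: eq_has => c; apply: cle_swap.
have HD d : fsat d.1 d.2 (Box (Dia B)) = has (cle Q ^~ d) M.2.
  have Bx v w f : fsat v w (Box f) = fsat v w f && fsat w v f by [].
  by rewrite Bx !fsat_Dia HB HB' !orbb andbb.
have -> : rsat N.1 N.2 (Box (Dia B)) =
   rsat N.1 N.2 (Dia B) && all (fun c => fsat c.1 c.2 (Box (Dia B))) N.2 by [].
rewrite (eq_all HD) rsat_Dia.
case: allP => [H|_]; last by rewrite andbF.
(* The instance of the box at the root follows from those at the clusters, because there is at least
   one cluster. *)
rewrite andbT; apply/orP; right.
case: N.2 N0 H => // d T _ H; apply/hasP; exists d; first exact: mem_head.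
by rewrite HB H // mem_head.
Qed.

Lemma pol_sub_Var Q p : p \in Q Plus -> pol_sub Q (Var p).
Proof. by move=> Qp [] /=; rewrite ?fsub1set. Qed.

Lemma pol_sub_bigAnd (T : eqType) Q (F : T -> formula) s :
  (forall x, x \in s -> pol_sub Q (F x)) -> pol_sub Q (bigAnd (map F s)).
Proof.
elim: s => [_ []//|x s IH H]; apply/pol_sub_And.
split; first by apply: H; apply: mem_head.
by apply: IH => y ys; apply: H; rewrite inE ys orbT.
Qed.

Lemma pol_sub_bigOr (T : eqType) Q (F : T -> formula) s :
  (forall x, x \in s -> pol_sub Q (F x)) -> pol_sub Q (bigOr (map F s)).
Proof.
elim: s => [_ []//|x s IH H]; apply/pol_sub_Or.
split; first by apply: H; apply: mem_head.
by apply: IH => y ys; apply: H; rewrite inE ys orbT.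
Qed.

Lemma pol_sub_Dia Q f : pol_sub Q f -> pol_sub Q (Dia f).
Proof. by move=> Qf s /=; rewrite flipK. Qed.

Lemma pol_sub_lit Q v : pol_sub Q (lit Q v).
Proof.
apply/pol_sub_And; split; apply: pol_sub_bigAnd => p; rewrite inE => /andP[_ Qp].
  exact: pol_sub_Var.
by apply/pol_sub_Neg; apply: pol_sub_Var.
Qed.

Lemma pol_sub_cluster_form Q c : pol_sub Q (cluster_form Q c).
Proof.
have L := @pol_sub_lit Q.
apply/pol_sub_And; split; last by apply/pol_sub_Box/pol_sub_Or.
by apply/pol_sub_And; split; apply/pol_sub_Box/pol_sub_Dia.
Qed.

Lemma pol_sub_char_form Q M : pol_sub Q (char_form Q M).
Proof.
apply/pol_sub_And; split; first exact: pol_sub_lit.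
apply/pol_sub_And; split.
  by apply: pol_sub_bigAnd => c _; apply/pol_sub_Dia/pol_sub_cluster_form.
apply/pol_sub_Box/pol_sub_Dia.
apply: pol_sub_bigOr => c _; exact: pol_sub_cluster_form.
Qed.

(** * Amalgamation *)

Section Amalgamation.

Variables (Q Q1 Q2 : polarity -> val).
Hypothesis Q12 : forall s p, p \in Q1 s -> p \in Q2 s -> p \in Q s.

(* The least valuation above [x] for [Q1] and below [y] for [Q2]. *)
Definition amalg (x y : val) : val := (x `&` Q1 Plus) `|` (y `&` Q2 Minus).

(** Only a variable contributed by [y] could violate the negative clause. It is then negative for
    both [Q1] and [Q2], hence in [Q Minus], and [le Q x y] puts it in [x]. The next lemma is dual,
    with positive variables. *)
Lemma le_amalg_l x y : le Q x y -> le Q1 x (amalg x y).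
Proof.
move=> /leP[H1 H2]; apply/leP; split=> p Qp; rewrite !inE.
  by move=> ->; rewrite Qp.
by move=> /orP[] /andP[// yp Q2p]; apply: H2 => //; apply: Q12.
Qed.

Lemma le_amalg_r x y : le Q x y -> le Q2 (amalg x y) y.
Proof.
move=> /leP[H1 H2]; apply/leP; split=> p Qp; rewrite !inE; last first.
  by move=> ->; rewrite Qp orbT.
by move=> /orP[] /andP[// xp Q1p]; apply: H1 => //; apply: Q12.
Qed.

(** Meant for clusters with [cle Q c d], so that in the second branch the crossed matching is
    available. *)
Definition camalg (c d : val * val) : val * val :=
  if le Q c.1 d.1 && le Q c.2 d.2 then (amalg c.1 d.1, amalg c.2 d.2)
  else (amalg c.1 d.2, amalg c.2 d.1).

Lemma cle_camalg c d : cle Q c d ->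
  cle Q1 c (camalg c d) /\ cle Q2 (camalg c d) d.
Proof.
rewrite /cle /camalg; case: ifP => [/andP[l1 l2] _|_ /= /andP[l1 l2]] /=.
  by rewrite !le_amalg_l // !le_amalg_r.
by rewrite !le_amalg_l // !le_amalg_r // orbT.
Qed.

Definition mamalg (M N : val * seq (val * val)) : val * seq (val * val) :=
  (amalg M.1 N.1,
   [seq camalg p.1 p.2 | p <- [seq (c, d) | c <- M.2, d <- N.2] & cle Q p.1 p.2]).

Lemma mem_mamalg M N c d : c \in M.2 -> d \in N.2 -> cle Q c d ->
  camalg c d \in (mamalg M N).2.
Proof.
move=> cM dN cd; apply/mapP; exists (c, d) => //.
by rewrite mem_filter cd /=; apply/allpairsP; exists (c, d).
Qed.

Lemma mamalgP M N k : k \in (mamalg M N).2 ->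
  exists c d, [/\ c \in M.2, d \in N.2, cle Q c d & k = camalg c d].
Proof.
case/mapP => p; rewrite mem_filter => /andP[cd /allpairsP[q [q1 q2 pq]]] ->.
by exists q.1, q.2; rewrite pq in cd *.
Qed.

(** Every cluster of the amalgam comes from a related pair and so has both projections. Conversely,
    forth gives each cluster of [M] a partner in [N], back gives each cluster of [N] one in [M], and
    such a pair is a cluster of the amalgam. *)
Lemma mle_mamalg M N : mle Q M N ->
  mle Q1 M (mamalg M N) /\ mle Q2 (mamalg M N) N.
Proof.
move=> /and3P[r /allP forth /allP back].
split; apply/and3P; split; rewrite ?le_amalg_l ?le_amalg_r //; apply/allP.
- move=> c cM; have /hasP[d dN cd] := forth c cM; apply/hasP.
  by exists (camalg c d); [exact: mem_mamalg | case: (cle_camalg cd)].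
- move=> k /mamalgP[c [d [cM dN cd ->]]]; apply/hasP; exists c => //.
  by case: (cle_camalg cd).
- move=> k /mamalgP[c [d [cM dN cd ->]]]; apply/hasP; exists d => //.
  by case: (cle_camalg cd).
- move=> d dN; have /hasP[c cM cd] := back d dN; apply/hasP.
  by exists (camalg c d); [exact: mem_mamalg | case: (cle_camalg cd)].
Qed.

End Amalgamation.

(** * Restriction to finitely many variables *)

Section Restriction.

Variable X : val.

Definition crestr (c : val * val) : val * val := (c.1 `&` X, c.2 `&` X).

(** The order and multiplicity of clusters do not affect [mle]; collecting them in a set leaves only
    finitely many restricted models. *)
Definition mrestr (N : val * seq (val * val)) : val * {fset val * val} :=
  (N.1 `&` X, [fset crestr c | c in N.2]).

Definition restr_models : {fset val * {fset val * val}} :=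
  fpowerset X `*` fpowerset (fpowerset X `*` fpowerset X).

Lemma mrestr_models N : mrestr N \in restr_models.
Proof.
rewrite in_fsetM !fpowersetE fsubsetIr /=; apply/fsubsetP => _ /imfsetP[c _ ->].
by rewrite in_fsetM !fpowersetE !fsubsetIr.
Qed.

(** A model and its restriction agree on [X]. One direction will carry [phi] to the restriction, the
    other will make the model satisfy the characteristic formula of the restriction. *)
Lemma mle_mrestr Q N : (forall s, Q s `<=` X) ->
  mle Q ((mrestr N).1, enum_fset (mrestr N).2) N /\
  mle Q N ((mrestr N).1, enum_fset (mrestr N).2).
Proof.
move=> QX.
have lel v : le Q (v `&` X) v.
  apply/leP; split=> p Qp; rewrite inE; first by case/andP.
  by move=> ->; apply: (fsubsetP (QX Minus)).
have ler v : le Q v (v `&` X).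
  apply/leP; split=> p Qp; rewrite inE; last by case/andP.
  by move=> ->; apply: (fsubsetP (QX Plus)).
have cl c : cle Q (crestr c) c by rewrite /cle !lel.
have cr c : cle Q c (crestr c) by rewrite /cle !ler.
split; apply/and3P; split=> //=; apply/allP.
- by move=> _ /imfsetP[c cN ->]; apply/hasP; exists c.
- by move=> c cN; apply/hasP; exists (crestr c) => //; apply/imfsetP; exists c.
- by move=> c cN; apply/hasP; exists (crestr c) => //; apply/imfsetP; exists c.
- by move=> _ /imfsetP[c cN ->]; apply/hasP; exists c.
Qed.

End Restriction.

(** * The interpolant *)

Lemma mle_neq0 Q M N : mle Q M N -> N.2 != [::] -> M.2 != [::].
Proof. by case: M N => [u [|c S]] [w [|d T]] //= /and3P[]. Qed.

(** The models range over all variables of [phi], so that [phi] can be evaluated in them, while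
    their characteristic formulas speak only of [Q]. *)
Definition interpolant (Q : polarity -> val) (phi : formula) : formula :=
  let X := vars Plus phi `|` vars Minus phi in
  bigOr [seq char_form Q (M.1, enum_fset M.2) |
         M : val * {fset val * val} <- restr_models X & rsat M.1 M.2 phi].

Theorem theorem8p2 : ULIP Gamma_LP2_2_1.
Proof.
move=> phi P; pose Q s := vars s phi `\` P s.
set X := vars Plus phi `|` vars Minus phi.
have phiX : pol_sub (fun=> X) phi := @pol_sub_allvars phi.
exists (interpolant Q phi); split.
- apply: valid_Gamma => u S S0; apply/implyP => Hphi.
  rewrite -/(rsat _ _ _) /interpolant rsat_bigOr has_map.
  apply/hasP; exists (mrestr X (u, S)).
    rewrite mem_filter mrestr_models andbT.
    have [|_ le2] := @mle_mrestr X (fun=> X) (u, S); first by [].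
    exact: rsat_mono le2 Hphi.
  rewrite [preim _ _ _](@rsat_char_form Q _ (u, S)) //.
  have [|//] := @mle_mrestr X Q (u, S).
  by move=> s; apply: fsubset_trans (fsubsetDl _ _) (phiX s).
- by apply: pol_sub_bigOr => M _; apply: pol_sub_char_form.
- move=> psi /Gamma_valid phi_psi psiP; apply: valid_Gamma => u S S0.
  apply/implyP; rewrite -/(rsat _ _ _) /interpolant rsat_bigOr has_map.
  move=> /hasP[M].
  rewrite mem_filter => /andP[Mphi _].
  rewrite [preim _ _ _](@rsat_char_form Q _ (u, S)) // => MN.
  (* A variable of [psi] avoids [P] in its polarity, so one shared with [phi] survives in [Q]. *)
  have Q12 s p : p \in vars s phi -> p \in vars s psi -> p \in Q s.
    move=> p1 p2; rewrite inE p1 andbT; apply/negP => p3.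
    by have /fsetP/(_ p) := psiP s; rewrite !inE p2 p3.
  have [] := mle_mamalg Q12 MN; set K := mamalg _ _ _ _ _ => MK KN.
  have Kphi : rsat K.1 K.2 phi by apply: (rsat_mono _ MK Mphi).
  have Kimp : rsat K.1 K.2 phi ==> rsat K.1 K.2 psi.
    (* The amalgam has a final cluster because each cluster of [(u, S)] has one below it. *)
    exact: (phi_psi _ _ (mle_neq0 KN S0)).
  exact: (rsat_mono _ KN (implyP Kimp Kphi)).
Qed.
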